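(* Let $G=\langle a,b,c\mid a^2=b^2=c^2=1\rangle=(\mathbb{Z}/2\mathbb{Z})*(\mathbb{Z}/2\mathbb{Z})*(\mathbb{Z}/2\mathbb{Z})$, let $X$ be its Cayley graph (the infinite trivalent tree) with its path metric $d$, fix $0<\delta<1$, and let $\mu$ be the probability distribution with atoms of weight $1/3$ at the three vertices $a,b,c$ of $X$. Then there is an optimal one-sample estimator with quality $2/3$, but the quality of any shift-invariant one-sample estimator (left-invariant or right-invariant) is at most $1/3$.
   Context: The Cayley graph $X$ has one vertex for each element of $G$, with an edge joining vertices $w$ and $x$ if and only if $w=xa$, $w=xb$, or $w=xc$; each edge has length one, and $d$ is the resulting metric (on vertices, $d(w,x)$ is the length of the reduced word for $w^{-1}x$). $G$ acts on $X$ by left multiplication. For $\theta\in G$, $\mu_\theta(A)=\mu(\{x:\theta x\in A\})$, so $\mu_\theta$ has atoms of weight $1/3$ at $\theta a,\theta b,\theta c$. A one-sample estimator is a function $e$ from the vertices of $X$ (that is, from $G$) to $G$. Its ($\delta$-)quality is $Q(e)=\inf_{\theta\in G}\mu_\theta(\{x:d(e(x),\theta)<\delta\})$. It is optimal if $Q(e)\ge Q(e')$ for all one-sample estimators $e'$. It is left-invariant if $e(gx)=g\,e(x)$ for all $g,x\in G$, and right-invariant if $e(xg)=e(x)g$ for all $g,x\in G$; shift-invariant means left-invariant or right-invariant. *)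

(* Defs.v *)
From HB Require Import structures.
From mathcomp Require Import all_boot all_order all_algebra.
From mathcomp Require Import all_classical all_reals all_analysis.

Set Implicit Arguments.
Unset Strict Implicit.
Unset Printing Implicit Defensive.
Import Order.TTheory GRing.Theory Num.Theory.

(* The group <a, b, c | a^2 = b^2 = c^2 = 1> is realised by its normal forms:
   words over a three-letter alphabet without two equal adjacent letters.
   Lemma triG_presentation below states that this is the presented group. *)
Definition reduced (w : seq 'I_3) : bool := sorted (fun s t => s != t) w.

Definition triG : Type := {w : seq 'I_3 | reduced w}.

HB.instance Definition _ := Choice.on triG.

Definition cons_red (s : 'I_3) (w : seq 'I_3) : seq 'I_3 :=
  if w is t :: w' then if s == t then w' else s :: w else [:: s].

Definition cat_red (u v : seq 'I_3) : seq 'I_3 := foldr cons_red v u.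

Lemma reduced_behead s w : reduced (s :: w) -> reduced w.
Proof. exact: path_sorted. Qed.

Lemma cons_red_reduced s w : reduced w -> reduced (cons_red s w).
Proof.
case: w => // t w; rewrite /cons_red; case: eqP => [_|/eqP st tw].
  exact: reduced_behead.
by rewrite /reduced /= st.
Qed.

Lemma cat_red_reduced u v : reduced v -> reduced (cat_red u v).
Proof. by move=> rv; elim: u => //= s u; exact: cons_red_reduced. Qed.

Lemma cons_redK s w : reduced w -> cons_red s (cons_red s w) = w.
Proof.
case: w => [|t w] /=; first by rewrite eqxx.
have [->|st] := eqVneq s t; last by rewrite /= eqxx.
by case: w => [|r w] //= /andP[/negPf ->].
Qed.

Lemma cons_red_id s w : reduced (s :: w) -> cons_red s w = s :: w.
Proof. by case: w => //= t w /andP[/negPf ->]. Qed.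

Lemma size_cons_red s w : size (cons_red s w) <= (size w).+1.
Proof.
by case: w => //= t w; case: (s == t) => //=; exact/leqW/leqW.
Qed.

Lemma cat_red_cons_red s u v :
  reduced v -> cat_red (cons_red s u) v = cons_red s (cat_red u v).
Proof.
case: u => [|t u] //= rv; have [->|//] := eqVneq s t.
by rewrite cons_redK //; exact: cat_red_reduced.
Qed.

Lemma cat_redA u v w :
  reduced w -> cat_red u (cat_red v w) = cat_red (cat_red u v) w.
Proof.
move=> rw; elim: u => //= s u ->.
by rewrite cat_red_cons_red.
Qed.

Lemma cat_red0 u : reduced u -> cat_red u [::] = u.
Proof.
elim: u => //= s u IH su.
by rewrite IH ?cons_red_id //; exact: reduced_behead su.
Qed.

Lemma rev_reduced u : reduced u -> reduced (rev u).
Proof.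
move=> ru; rewrite /reduced rev_sorted (eq_sorted (e' := fun s t => s != t)) //.
by move=> s t; rewrite eq_sym.
Qed.

Lemma cat_red_rev u v : reduced v -> cat_red (rev u) (cat_red u v) = v.
Proof.
elim: u v => //= s u IH v rv.
rewrite rev_cons /cat_red -cats1 foldr_cat /= -/(cat_red u v).
by rewrite cons_redK ?cat_red_reduced //; exact: IH.
Qed.

Definition triG1 : triG := exist _ [::] isT.
Definition triG_mul (x y : triG) : triG :=
  exist _ (cat_red (val x) (val y)) (cat_red_reduced (val x) (valP y)).
Definition triG_inv (x : triG) : triG :=
  exist _ (rev (val x)) (rev_reduced (valP x)).

Lemma triG_mulA : associative triG_mul.
Proof. by move=> x y z; apply: val_inj; rewrite /= cat_redA ?(valP z). Qed.

Lemma triG_mul1g : left_id triG1 triG_mul.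
Proof. by move=> x; apply: val_inj. Qed.

Lemma triG_mulg1 : right_id triG1 triG_mul.
Proof. by move=> x; apply: val_inj; rewrite /= cat_red0 ?(valP x). Qed.

Lemma triG_mulVg : left_inverse triG1 triG_inv triG_mul.
Proof.
move=> x; apply: val_inj => /=.
by rewrite -[X in cat_red _ X]cat_red0 ?(valP x) // cat_red_rev.
Qed.

Lemma triG_mulgV : right_inverse triG1 triG_inv triG_mul.
Proof.
have invK x : triG_inv (triG_inv x) = x by apply: val_inj; rewrite /= revK.
by move=> x; rewrite -{1}(invK x) triG_mulVg.
Qed.

HB.instance Definition _ := isGroup.Build triG
  triG_mulA triG_mul1g triG_mulg1 triG_mulVg triG_mulgV.

Definition gen (s : 'I_3) : triG := exist _ [:: s] isT.
Definition a : triG := gen (@Ordinal 3 0 isT).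
Definition b : triG := gen (@Ordinal 3 1 isT).
Definition c : triG := gen (@Ordinal 3 2 isT).

Section Presentation.
Local Open Scope group_scope.

Lemma gen_sqr s : gen s ^+ 2 = 1.
Proof. by apply: val_inj; rewrite /= eqxx. Qed.

Lemma gen_abc s : [\/ gen s = a, gen s = b | gen s = c].
Proof.
by case: s => -[|[|[|//]]] H; [apply: Or31|apply: Or32|apply: Or33];
   congr gen; apply: val_inj.
Qed.

Lemma gen_cons s w (sw : reduced (s :: w)) :
  exist _ (s :: w) sw = gen s * exist _ w (reduced_behead sw) :> triG.
Proof. by apply: val_inj; rewrite /= cons_red_id. Qed.

(* The elements a, b, c satisfy the relations, and triG is universal among groups
   with three such elements, so triG is <a, b, c | a^2 = b^2 = c^2 = 1>. *)
Lemma triG_presentation :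
  [/\ a ^+ 2 = 1, b ^+ 2 = 1 & c ^+ 2 = 1] /\
  forall (H : groupType) (x y z : H),
    x ^+ 2 = 1 -> y ^+ 2 = 1 -> z ^+ 2 = 1 ->
    exists f : triG -> H,
      [/\ {morph f : u v / u * v}, f a = x, f b = y, f c = z &
          forall f' : triG -> H, {morph f' : u v / u * v} ->
            f' a = x -> f' b = y -> f' c = z -> f' = f].
Proof.
split=> [|H x y z x2 y2 z2]; first by split; exact: gen_sqr.
pose h (s : 'I_3) := nth 1 [:: x; y; z] s.
have h2 s : h s * h s = 1.
  by case: s => -[|[|[|//]]] ?; rewrite /h /= -expg2.
pose F (w : seq 'I_3) : H := foldr (fun s p => h s * p) 1 w.
have Fcons s w : F (cons_red s w) = h s * F w.
  case: w => [|t w] //=; have [->|//] := eqVneq s t.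
  by rewrite mulgA h2 mul1g.
have FM u v : F (cat_red u v) = F u * F v.
  by elim: u => [|s u IH] /=; rewrite ?mul1g // Fcons IH mulgA.
exists (fun u => F (val u)); split; rewrite /= /h /= ?mulg1 //.
  by move=> u v; exact: FM.
move=> f fM fa fb fc; have f1 : f 1 = 1.
  by apply: (mulgI (f 1)); rewrite -fM !mulg1.
have fgen s : f (gen s) = h s.
  case: s => -[|[|[|//]]] Hs; rewrite /h /= -?fa -?fb -?fc;
  by congr (f (gen _)); apply: val_inj.
apply/funext => -[w]; elim: w => [|s w IH] ws /=.
  by rewrite -f1; congr f; apply: val_inj.
by rewrite gen_cons fM fgen IH.
Qed.

Definition cayley_adj : rel triG :=
  fun w x => [|| w == x * a, w == x * b | w == x * c].

Lemma cayley_adjP w x :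
  reflect (exists s, w^-1 * x = gen s) (cayley_adj w x).
Proof.
have gV s : (gen s)^-1 = gen s by apply: val_inj.
apply: (iffP or3P) => [|[s wx]].
  by case=> /eqP ->; rewrite invgM mulgVK gV; eexists.
have -> : w = x * gen s by rewrite -(gV s) -wx invgM invgK mulgA mulgV mul1g.
by case: (gen_abc s) => ->; [apply: Or31|apply: Or32|apply: Or33].
Qed.

End Presentation.

Section Metric.
Context {R : realType}.
Local Open Scope classical_set_scope.

(* The path metric of the Cayley graph, on vertices: the least number of edges
   of a path from w to x. The path p lists the vertices after w.
   The set of lengths is never empty (see distE). *)
Definition dist (w x : triG) : R :=
  inf [set ((size p)%:R)%R |
       p in [set p : seq triG | path cayley_adj w p /\ last w p = x]].

Lemma distE (w x : triG) : dist w x = ((size (val (w^-1 * x)%g))%:R)%R.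
Proof.
have lb p : path cayley_adj w p ->
    (size (val (w^-1 * last w p)%g) <= size p)%N.
  elim: p w => [|y p IH] w; first by rewrite [last _ _]/= mulVg.
  move=> /andP[/cayley_adjP[s wy] /IH le_p]; rewrite [last _ _]/=.
  have -> : (w^-1 * last y p = gen s * (y^-1 * last y p))%g.
    by rewrite -wy -mulgA mulVKg.
  move: le_p; set u := (y^-1 * _)%g => le_p.
  apply: (@leq_trans (size (val u)).+1) => //.
  exact: (size_cons_red s (val u)).
have ub : exists p, [/\ path cayley_adj w p, last w p = x &
    size p = size (val (w^-1 * x)%g)].
  move: {2}(val _) (erefl (val (w^-1 * x)%g)) => v; clear lb.
  elim: v w => [|s v IH] w wx.
    exists [::]; split=> //; last by rewrite wx.
    by apply: (mulgI w^-1%g); rewrite mulVg; exact/esym/val_inj.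
  have sv : reduced (s :: v) by rewrite -wx (valP (w^-1 * x)%g).
  have wxE : (w^-1 * x)%g = (gen s * exist _ v (reduced_behead sv))%g.
    by rewrite -gen_cons; exact: val_inj.
  have [|p [pp lp sp]] := IH (w * gen s)%g.
    by rewrite invgM -mulgA wxE mulKg.
  exists ((w * gen s)%g :: p); split => //.
    rewrite [path _ _ _]/= pp andbT; apply/cayley_adjP; exists s.
    by rewrite mulKg.
  by rewrite wx [size _]/= sp invgM -mulgA wxE mulKg.
rewrite /dist; set S := (X in inf X); set l := (_%:R)%R.
have Sl : S l by have [p [pp lp sp]] := ub; exists p => //; rewrite sp.
have lbS : lbound S l.
  by move=> _ [p [pp lp] <-]; rewrite /l ler_nat -lp lb.
apply/eqP; rewrite eq_le; apply/andP; split.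
  by apply: ge_inf => //; exists l.
by apply: lb_le_inf => //; exists l.
Qed.

End Metric.

HB.instance Definition _ := isPointed.Build triG triG1.
HB.instance Definition _ := @isMeasurable.Build default_measure_display
  triG discrete_measurable discrete_measurable0
  discrete_measurableC discrete_measurableU.

Section Law.
Context {R : realType}.
Local Open Scope ereal_scope.

Definition mu (A : set triG) : \bar R :=
  (3^-1)%:E * (dirac a A + dirac b A + dirac c A).

Let mu_msum : mu =
  mscale ((3^-1)%:nng)%R (msum (fun i => dirac (nth triG1 [:: a; b; c] i)) 3%N).
Proof.
apply/funext => A; rewrite /mu /mscale /=; congr (_ * _).
by rewrite /msum 3!big_ord_recl big_ord0 /= adde0 addeA.
Qed.

Let mu0 : mu set0 = 0. Proof. by rewrite mu_msum measure0. Qed.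

Let mu_ge0 A : 0 <= mu A. Proof. by rewrite mu_msum measure_ge0. Qed.

Let mu_sigma_additive : semi_sigma_additive mu.
Proof. by rewrite mu_msum; exact: measure_semi_sigma_additive. Qed.

HB.instance Definition _ := isMeasure.Build _ _ _ mu
  mu0 mu_ge0 mu_sigma_additive.

Let mu_setT : mu setT = 1.
Proof.
rewrite /mu !diracT -!EFinD -EFinM; congr _%:E.
by rewrite -(natrD _ 1 1) -(natrD _ 2 1) mulVf // pnatr_eq0.
Qed.

HB.instance Definition _ := Measure_isProbability.Build _ _ _ mu mu_setT.

Definition mu_at (theta : triG) : set triG -> \bar R :=
  pushforward mu (fun x => (theta * x)%g).

Definition quality (delta : R) (e : triG -> triG) : \bar R :=
  ereal_inf (range (fun theta : triG =>
    mu_at theta [set x | (dist (e x) theta < delta)%R])).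

Definition optimal (delta : R) (e : triG -> triG) : Prop :=
  forall e' : triG -> triG, quality delta e' <= quality delta e.

End Law.

Definition left_invariant (e : triG -> triG) : Prop :=
  forall g x : triG, e (g * x)%g = (g * e x)%g.

Definition right_invariant (e : triG -> triG) : Prop :=
  forall g x : triG, e (x * g)%g = (e x * g)%g.

Definition shift_invariant (e : triG -> triG) : Prop :=
  left_invariant e \/ right_invariant e.

(* Main.v *)
Require Import Defs.
From mathcomp Require Import all_boot all_order all_algebra.
From mathcomp Require Import all_classical all_reals all_analysis.

Import Order.TTheory GRing.Theory Num.Theory.
Local Open Scope ring_scope.

(** Distances are integers, so for [0 < delta < 1] an estimate is within [delta]
of [theta] only if it equals [theta]: the quality of [e] is one third of the
minimum over [theta] of the number of the three neighbours of [theta] that [e]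
sends to [theta].

No estimator achieves three everywhere, because the identity is a neighbour of
both [a] and [b] and cannot be sent to both ([hits_le2]). Two is achieved by
moving one step towards the identity of the tree: every vertex is the parent of
all its neighbours but at most one ([parent_hits]).

A shift-invariant [e] is determined by [e 1]: it multiplies by that element on
one side. So at [theta = 1] it is correct only on the observation
[(e 1)^-1], which is at most one of [a], [b], [c] ([shift_hits_le1]). *)

Definition hits (e : triG -> triG) (theta : triG) : nat :=
  #|[pred s : 'I_3 | e (theta * gen s)%g == theta]|.

Section Quality.
Context (R : realType) (delta : R).
Hypotheses (delta_gt0 : 0 < delta) (delta_lt1 : delta < 1).

Lemma dist_lt_delta (w x : triG) : (dist w x < delta) = (w == x).
Proof using delta_gt0 delta_lt1.
rewrite distE; have [->|wx] := eqVneq w x; first by rewrite mulVg.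
apply/negbTE; rewrite -leNgt (le_trans (ltW delta_lt1)) // ler1n lt0n.
apply: contraNneq wx => /size0nil wx1.
have {}wx1 : (w^-1 * x)%g = 1%g by exact: val_inj.
by apply/eqP/(mulgI w^-1%g); rewrite mulVg wx1.
Qed.

Lemma mu_at_hits (e : triG -> triG) (theta : triG) :
  mu_at theta [set x | dist (e x) theta < delta] = ((hits e theta)%:R / 3)%:E :> \bar R.
Proof using delta_gt0 delta_lt1.
rewrite /mu_at /pushforward /mu !diracE -!EFinD -EFinM; congr _%:E.
rewrite mulrC; congr (_ / _); rewrite -!natrD; congr _%:R.
rewrite /hits -sum1_card big_mkcond 3!big_ord_recl big_ord0 /= addn0 addnA.
have inE' s : (gen s \in (fun x => (theta * x)%g) @^-1`
    [set x | dist (e x) theta < delta])%classic = (e (theta * gen s)%g == theta).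
  by rewrite -dist_lt_delta; apply/idP/idP; rewrite inE.
rewrite !inE'.
(* The indices of a, b, c and of the expanded sum agree only as numbers. *)
by congr (_ + _ + _)%N; congr (nat_of_bool (e (_ * gen _)%g == _));
   exact: val_inj.
Qed.

Lemma quality_le (n : nat) (e : triG -> triG) (theta : triG) :
  (hits e theta <= n)%N -> (quality delta e <= (n%:R / 3)%:E)%E.
Proof using delta_gt0 delta_lt1.
move=> hn; apply: (@le_trans _ _ ((hits e theta)%:R / 3)%:E).
  by apply: ereal_inf_lbound; exists theta => //; exact: mu_at_hits.
by rewrite lee_fin ler_pM2r ?invr_gt0 ?ltr0n // ler_nat.
Qed.

Lemma quality_ge (n : nat) (e : triG -> triG) :
  (forall theta, (n <= hits e theta)%N) -> ((n%:R / 3)%:E <= quality delta e)%E.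
Proof using delta_gt0 delta_lt1.
move=> hn; apply: le_ereal_inf_tmp => _ [theta _ <-].
by rewrite mu_at_hits lee_fin ler_pM2r ?invr_gt0 ?ltr0n // ler_nat.
Qed.

End Quality.

Lemma hits_le2_at_gen (e : triG -> triG) (s : 'I_3) :
  e 1%g != gen s -> (hits e (gen s) <= 2)%N.
Proof.
move=> es; rewrite -ltnS -[X in (_ < X)%N]card_ord; apply/proper_card/properP.
by split; [exact/fintype.subsetP | exists s; rewrite // inE -expg2 gen_sqr].
Qed.

(** The observation [1] is possible under both [a] and [b], and [e 1] is wrong
for at least one of them. *)
Lemma hits_le2 (e : triG -> triG) : exists theta, (hits e theta <= 2)%N.
Proof.
have [ea|] := eqVneq (e 1%g) a; last by exists a; exact: hits_le2_at_gen.
by exists b; apply: hits_le2_at_gen; rewrite ea.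
Qed.

(** Deletes the last letter. Going through inverses puts that letter at the
head, where [cons_red] computes multiplication by a generator. *)
Definition parent (x : triG) : triG :=
  (exist _ (drop 1 (val x^-1%g))
     (drop_sorted (s := val x^-1%g) 1 (valP x^-1%g)) : triG)^-1%g.

Lemma parent_mul_gen (theta : triG) (s : 'I_3) :
  ohead (val theta^-1%g) != Some s -> parent (theta * gen s)%g = theta.
Proof.
move=> hs; rewrite /parent -[RHS]invgK; congr (_^-1)%g; apply: val_inj.
change (drop 1 (val (theta * gen s)^-1%g) = val theta^-1%g).
rewrite invgM drop1.
change (behead (cons_red s (val theta^-1%g)) = val theta^-1%g).
case: (val theta^-1%g) hs => [|t w] //=.
by rewrite eq_sym (inj_eq Some_inj) => /negPf ->.
Qed.

(** Only the last letter of [theta] leads from [theta] to its own parent; the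
other generators lead to children. *)
Lemma parent_hits (theta : triG) : (2 <= hits parent theta)%N.
Proof.
pose s := odflt ord0 (ohead (val theta^-1%g)).
have -> : 2%N = #|predC1 s| by rewrite cardC1 card_ord.
apply/subset_leq_card/fintype.subsetP => t; rewrite !inE => ts; apply/eqP.
apply: parent_mul_gen; move: ts; rewrite /s.
by case: ohead => //= r; rewrite (inj_eq Some_inj) eq_sym.
Qed.

Lemma shift_eq1 (e : triG -> triG) (x : triG) :
  shift_invariant e -> e x = 1%g -> x = (e 1)^-1%g.
Proof.
move=> [] inv ex; [have := inv x 1%g | have := inv x 1%g].
  by rewrite mulg1 ex => /esym x1; rewrite -[x](mulgK (e 1%g)) x1 mul1g.
by rewrite mul1g ex => /esym x1; rewrite -[x](mulKg (e 1%g)) x1 mulg1.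
Qed.

Lemma shift_hits_le1 (e : triG -> triG) :
  shift_invariant e -> (hits e 1%g <= 1)%N.
Proof.
move=> inv; apply/card_le1_eqP => s t; rewrite !inE !mul1g.
move=> /eqP /(shift_eq1 _ _ inv) sE /eqP /(shift_eq1 _ _ inv).
by rewrite -sE => /(congr1 val) [].
Qed.

Theorem mainTheorem6 (R : realType) (delta : R)
    (delta_gt0 : 0 < delta) (delta_lt1 : delta < 1) :
  (exists e : triG -> triG,
      optimal delta e /\ quality delta e = (2 / 3)%:E) /\
  (forall e : triG -> triG,
      shift_invariant e -> (quality delta e <= (1 / 3)%:E)%E).
Proof.
have le23 e : (quality delta e <= (2 / 3)%:E)%E.
  by have [theta] := hits_le2 e; exact: quality_le.
split; last first.
  by move=> e /shift_hits_le1; exact: quality_le.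
have parentE : quality delta parent = (2 / 3)%:E.
  by apply/eqP; rewrite eq_le le23 quality_ge // => theta; exact: parent_hits.
by exists parent; split; rewrite // /optimal parentE.
Qed.
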